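(* Let $\mathsf R$ be a multivariate Ore extension of a domain $R$, let $F=\{g_1,\dots,g_u\}\subset\mathsf R^m\setminus\{0\}$ be a finite set which is a bilateral Gröbner basis of $\mathsf M:=\mathbb I_2(F)$, and let $\mathfrak{GM}(F)$ be a bilateral Gebauer–Möller set for $F$ (so that each $\sigma\in\mathfrak{GM}(F)$ has a lifting; let $\mathrm{lift}(\sigma)$ denote one). Then $\{\mathrm{lift}(\sigma):\sigma\in\mathfrak{GM}(F)\}$ is a bilateral standard basis of $\ker(\mathfrak S_2)$.
   Context: **Ore extensions.** $R$ is a (not necessarily commutative) domain with identity. A multivariate Ore extension $\mathsf R=R[Y_1;\alpha_1,\delta_1]\cdots[Y_n;\alpha_n,\delta_n]$ is an iterated Ore extension ($Y_i\star r=\alpha_i(r)Y_i+\delta_i(r)$, $\alpha_i$ an injective ring endomorphism mapping $R$ to $R$, $\delta_i$ an $\alpha_i$-derivation mapping $R$ to $R$, i.e. additive with $\delta_i(rr')=\alpha_i(r)\delta_i(r')+\delta_i(r)r'$) such that $\alpha_j\delta_i=\delta_i\alpha_j$ for $i\ne j$, $\alpha_i\alpha_j=\alpha_j\alpha_i$, $\delta_i\delta_j=\delta_j\delta_i$, and $\alpha_j(Y_i)=Y_i$, $\delta_j(Y_i)=0$ for $i<j$. Its multiplication is $\star$. It is a free left $R$-module on the set of terms $\mathcal T=\{Y_1^{a_1}\cdots Y_n^{a_n}\}$, a commutative monoid whose product is written $\circ$. For $\tau=Y_1^{a_1}\cdots Y_n^{a_n}$ put $\alpha_\tau=\alpha_1^{a_1}\cdots\alpha_n^{a_n}:R\to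 R$. The associated graded Ore extension $\mathsf S=R[Y_1;\alpha_1]\cdots[Y_n;\alpha_n]$ is the same left $R$-module with multiplication $\ast$ determined by $(a\tau)\ast(b\omega)=a\,\alpha_\tau(b)\,\tau\circ\omega$. **Orderings.** $\mathsf R^m$ has canonical basis $\mathbf e_1,\dots,\mathbf e_m$ (with $r\star(s\mathbf e_i)\star t=(r\star s\star t)\mathbf e_i$) and terms $\mathcal T^{(m)}=\{t\mathbf e_i\}$. Fix a term ordering $\prec$ on $\mathcal T$ and a compatible term ordering $<$ on $\mathcal T^{(m)}$: a well-ordering with $\omega_1\prec\omega_2\Rightarrow\omega_1t<\omega_2t$ and $t_1<t_2\Rightarrow\omega t_1<\omega t_2$. For $f\ne0$, $\mathbf T(f)$ is its maximal term, $\mathrm{lc}(f)\in R$ the coefficient of $\mathbf T(f)$, and $\mathbf M(f)=\mathrm{lc}(f)\mathbf T(f)$. **Gröbner basis.** $F$ is a bilateral (weak) Gröbner basis of the bilateral module $\mathsf M=\mathbb I_2(F)$ it generates if for every $f\in\mathsf M\setminus\{0\}$, $\mathbf M(f)=\sum_ia_i\lambda_i\ast\mathbf M(g_{\ell_i})\ast b_i\rho_i$ (finite sum) with $a_i,b_i\in R\setminus\{0\}$, $\lambda_i,\rho_i\in\mathcal T$, $\lambda_i\circ\mathbf T(g_{\ell_i})\circ\rho_i=\mathbf T(f)$. **Syzygies.** Let $\hat R=\{a\in R: a\star h=h\star a\ \forall h\in\mathsf R\}$ (contained also in the center of $\mathsf S$). The bimodules $(\mathsf R\otimes_{\hat R}\mathsf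 R^{\mathrm{op}})^u$ (over $\mathsf R$) and $(\mathsf S\otimes_{\hat R}\mathsf S^{\mathrm{op}})^u$ (over $\mathsf S$) coincide as sets, have canonical basis $e_1,\dots,e_u$, and their elements are written $\sigma=\sum_ia_i\lambda_ie_{\ell_i}b_i\rho_i$ with $a_i,b_i\in R\setminus\{0\}$, $\lambda_i,\rho_i\in\mathcal T$. As an additive group each is the direct sum, over $(\lambda,\ell,\rho)\in\mathcal T\times\{1,\dots,u\}\times\mathcal T$, of the components spanned by the $a\lambda e_\ell b\rho$ ($a,b\in R$), each a copy of $R\otimes_{\hat R}R$; the $(\lambda,\ell,\rho)$-component is given degree $\lambda\circ\mathbf T(g_\ell)\circ\rho\in\mathcal T^{(m)}$. For $\sigma\neq0$, $v(\sigma)$ is the $<$-largest degree of a nonzero component, and the leading form $\mathcal L_2(\sigma)\in(\mathsf S\otimes_{\hat R}\mathsf S^{\mathrm{op}})^u$ is the sum of the components of degree $v(\sigma)$; $\sigma$ is $\mathcal T^{(m)}$-homogeneous if $\sigma=\mathcal L_2(\sigma)$. Define $\mathfrak s_2:(\mathsf S\otimes_{\hat R}\mathsf S^{\mathrm{op}})^u\to\mathsf S^m$, $\sum a_i\lambda_ie_{\ell_i}b_i\rho_i\mapsto\sum a_i\lambda_i\ast\mathbf M(g_{\ell_i})\ast b_i\rho_i$, and $\mathfrak S_2:(\mathsf R\otimes_{\hat R}\mathsf R^{\mathrm{op}})^u\to\mathsf R^m$, $\sum a_i\lambda_ie_{\ell_i}b_i\rho_i\mapsto\sum a_i\lambda_i\star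 g_{\ell_i}\star b_i\rho_i$. A bilateral Gebauer–Möller set for $F$ is a set of (nonzero) $\mathcal T^{(m)}$-homogeneous generators of the $\mathsf S$-bimodule $\ker(\mathfrak s_2)$. A lifting of a homogeneous $\sigma\in\ker(\mathfrak s_2)$ is an element $U\in\ker(\mathfrak S_2)$ with $\mathcal L_2(U)=\sigma$. For an $\mathsf R$-subbimodule $\mathsf N$ of $(\mathsf R\otimes_{\hat R}\mathsf R^{\mathrm{op}})^u$, a set $B\subset\mathsf N$ is a bilateral standard basis of $\mathsf N$ if $\{\mathcal L_2(b):b\in B\setminus\{0\}\}$ and $\{\mathcal L_2(h):h\in\mathsf N\setminus\{0\}\}$ generate the same $\mathsf S$-subbimodule of $(\mathsf S\otimes_{\hat R}\mathsf S^{\mathrm{op}})^u$. *)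

(* Defs.v *)
From HB Require Import structures.
From mathcomp Require Import all_boot all_order all_algebra.
From mathcomp Require Import generic_quotient ring_quotient.
From mathcomp Require Import boolp classical_sets.
From mathcomp Require Import freeg mpoly.

Set Implicit Arguments.
Unset Strict Implicit.
Unset Printing Implicit Defensive.

Import GRing.Theory.
Local Open Scope ring_scope.
Local Open Scope quotient_scope.
Local Open Scope classical_set_scope.

(* Terms Y_1^a_1 ... Y_n^a_n are the monomials 'X_{1..n} (written additively in
   scope %MM), and the free left R-module on them is {mpoly R[n]}. *)

Section FreegLift.
Variables (R : nzRingType) (K : choiceType) (M : lmodType R) (f : K -> M).

Fact fglift0 : fglift f 0 = 0.
Proof. by have := lift_is_additive f 0 0; rewrite !subrr. Qed.

Fact fgliftB : {morph fglift f : x y / x - y}.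
Proof. exact: lift_is_additive. Qed.

Fact fgliftD : {morph fglift f : x y / x + y}.
Proof.
move=> x y; rewrite -{1}[y]opprK fgliftB -[- y]sub0r fgliftB.
by rewrite fglift0 sub0r opprK.
Qed.
End FreegLift.

(* y_1^(t 1) (y_2^(t 2) (... x)), for pairwise commuting maps y_i. *)
Definition mnm_iter (T : Type) n (y : 'I_n -> T -> T) (t : 'X_{1..n}) (x : T) :=
  foldr (fun i => iter (t i) (y i)) x (enum 'I_n).

Lemma mnm_iterU (T : Type) n (y : 'I_n -> T -> T) i t x :
    (forall j k z, y j (y k z) = y k (y j z)) ->
  mnm_iter y (U_(i) + t)%MM x = y i (mnm_iter y t x).
Proof.
move=> yC; rewrite /mnm_iter.
have C j k z : y i (iter k (y j) z) = iter k (y j) (y i z).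
  by elim: k => //= k <-; rewrite yC.
have ND r : i \notin r ->
    foldr (fun j => iter ((U_(i) + t)%MM j) (y j)) x r
    = foldr (fun j => iter (t j) (y j)) x r.
  elim: r => //= j r IH; rewrite inE negb_or => /andP[ij /IH ->].
  by rewrite mnmDE mnm1E (negPf ij).
have : i \in enum 'I_n by rewrite mem_enum.
elim: (enum 'I_n) (enum_uniq 'I_n) => //= j r IH /andP[jr ur].
rewrite inE; have [eq_ij|ij] /= := eqVneq i j.
  by rewrite -eq_ij in jr *; rewrite ND // mnmDE mnm1E eqxx.
by move=> /(IH ur) ->; rewrite C mnmDE mnm1E (negPf ij).
Qed.

Lemma mnm_iter0 (T : Type) n (y : 'I_n -> T -> T) x : mnm_iter y 0%MM x = x.
Proof. by rewrite /mnm_iter; elim: (enum 'I_n) => //= i r ->; rewrite mnm0E. Qed.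

Lemma mnm_Uind n (P : 'X_{1..n} -> Prop) :
  P 0%MM -> (forall i t, P t -> P (U_(i) + t)%MM) -> forall t, P t.
Proof.
move=> P0 PU t; have [k] := ubnP (mdeg t); elim: k t => // k IH t lt_k.
have [->|[i ti]] // : t = 0%MM \/ exists i, t i != 0%N.
  case: (pickP (fun i => t i != 0%N)) => [i ti|t0]; first by right; exists i.
  by left; apply/mnmP => i; rewrite mnm0E; apply/eqP/negbFE/t0.
have Ut : (U_(i) <= t)%MM.
  by apply/mnm_lepP => j; rewrite mnm1E; case: eqP => // <-; rewrite lt0n.
have def_t : t = (U_(i) + (t - U_(i)))%MM by rewrite addmC submK.
rewrite def_t; apply/PU/IH.
by move: lt_k; rewrite {1}def_t mdegD mdeg1.
Qed.


(* All the data of R[Y_1; alpha_1, delta_1] ... [Y_n; alpha_n, delta_n] live  *)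
(* on R: the remaining conditions alpha_j(Y_i) = Y_i, delta_j(Y_i) = 0 say    *)
(* that the variables commute.                                                *)
Record ore_data (R : nzRingType) (n : nat) := OreData {
  oalpha : 'I_n -> {rmorphism R -> R};
  odelta : 'I_n -> {additive R -> R};
  oalpha_inj : forall i, injective (oalpha i);
  odeltaM : forall i r s,
    odelta i (r * s) = oalpha i r * odelta i s + odelta i r * s;
  oalpha_delta : forall i j, i != j ->
    forall r, oalpha j (odelta i r) = odelta i (oalpha j r);
  oalphaC : forall i j r, oalpha i (oalpha j r) = oalpha j (oalpha i r);
  odeltaC : forall i j r, odelta i (odelta j r) = odelta j (odelta i r)
}.

Section OreMul.
Variables (R : nzRingType) (n : nat) (D : ore_data R n).
Implicit Types (f g h : {mpoly R[n]}) (t : 'X_{1..n}) (i j : 'I_n).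

(* Left multiplication by Y_i: sum r t |-> sum (alpha_i r) Y_i t + (delta_i r) t.
   The product on the right-hand side is that of {mpoly R[n]}, in which the
   variables commute with the coefficients. *)
Definition oreY i f : {mpoly R[n]} :=
  map_mpoly (oalpha D i) f * 'X_i + map_mpoly (odelta D i) f.

(* Left multiplication by Y_1^(t 1) ... Y_n^(t n). *)
Definition oreT t f : {mpoly R[n]} := mnm_iter oreY t f.

Definition oremul f g : {mpoly R[n]} :=
  \sum_(t <- msupp f) f@_t *: oreT t g.

Lemma mpoly_ext (G : zmodType) (F1 F2 : {mpoly R[n]} -> G) :
    {morph F1 : x y / x + y} -> {morph F2 : x y / x + y} ->
    (forall c t, F1 (c *: 'X_[t]) = F2 (c *: 'X_[t])) -> F1 =1 F2.
Proof.
move=> A1 A2 E f; rewrite (mpolyE f).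
have F0 (F : {mpoly R[n]} -> G) : {morph F : x y / x + y} -> F 0 = 0.
  by move=> A; apply: (addrI (F 0)); rewrite -A !addr0.
by elim: (msupp f) => [|t r IH]; rewrite ?big_nil ?F0 // big_cons A1 A2 E IH.
Qed.

Lemma map_mpolyZX (F : {additive R -> R}) c t :
  map_mpoly F (c *: 'X_[t] : {mpoly R[n]}) = F c *: 'X_[t].
Proof.
apply/mpolyP => s; rewrite mcoeff_map_mpoly !mcoeffZ !mcoeffX.
by case: eqP => _; rewrite ?mulr1 ?mulr0 ?raddf0.
Qed.

Lemma oreYX i c t :
  oreY i (c *: 'X_[t])
  = oalpha D i c *: 'X_[U_(i) + t] + odelta D i c *: 'X_[t].
Proof. by rewrite /oreY !map_mpolyZX -scalerAl -mpolyXD addmC. Qed.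

Lemma oreYD i : {morph oreY i : f g / f + g}.
Proof. by move=> f g; rewrite /oreY !raddfD mulrDl addrACA. Qed.

Lemma oreYC i j f : oreY i (oreY j f) = oreY j (oreY i f).
Proof.
have [-> //|ij] := eqVneq i j.
move: f; apply: mpoly_ext => [f g|f g|c t].
- by rewrite !oreYD.
- by rewrite !oreYD.
rewrite !oreYX !oreYD !oreYX !addmA [(U_(i) + U_(j))%MM]addmC oalphaC odeltaC.
rewrite (oalpha_delta D ij) (oalpha_delta D (i := j) (j := i)) 1?eq_sym //.
by rewrite !addrA; congr (_ + _); rewrite addrAC.
Qed.

Lemma oreYZ i c f :
  oreY i (c *: f) = oalpha D i c *: oreY i f + odelta D i c *: f.
Proof.
move: f; apply: mpoly_ext => [f g|f g|d t].
- by rewrite scalerDr oreYD.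
- by rewrite oreYD !scalerDr addrACA.
rewrite scalerA !oreYX odeltaM rmorphM scalerDr !scalerA scalerDl.
by rewrite addrA.
Qed.

Lemma oreTU i t f : oreT (U_(i) + t) f = oreY i (oreT t f).
Proof. by apply: mnm_iterU => j k g; apply: oreYC. Qed.

Lemma oreT0 f : oreT 0%MM f = f.
Proof. exact: mnm_iter0. Qed.

Lemma oreTD t : {morph oreT t : f g / f + g}.
Proof.
by move=> f g; elim/mnm_Uind: t => [|i t IH]; rewrite ?oreT0 // !oreTU IH oreYD.
Qed.

Lemma odelta1 i : odelta D i 1 = 0.
Proof.
have := odeltaM D i 1 1; rewrite mulr1 rmorph1 mul1r mulr1 => /eqP.
by rewrite -subr_eq0 opprD addNKr oppr_eq0 => /eqP.
Qed.

Lemma oreTX s t : oreT s 'X_[t] = 'X_[s + t].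
Proof.
elim/mnm_Uind: s => [|i s IH]; first by rewrite oreT0 add0m.
rewrite oreTU IH -[X in oreY i X]scale1r oreYX rmorph1 odelta1.
by rewrite scale0r addr0 scale1r addmA.
Qed.

Lemma oremulDl g : {morph (fun f => oremul f g) : f1 f2 / f1 + f2}.
Proof.
have E f : oremul f g = fglift (fun t => oreT t g : {mpoly R[n]}) (mpoly_val f).
  rewrite /oremul -[in RHS](freeg_sumE (mpoly_val f)) 
    (big_morph _ (@fgliftD _ _ _ _) (@fglift0 _ _ _ _)).
  by apply: eq_bigr => t _ /=; rewrite liftU.
by move=> f1 f2; rewrite !E -fgliftD.
Qed.

Lemma oremulX c t g : oremul (c *: 'X_[t]) g = c *: oreT t g.
Proof.
have [->|c0] := eqVneq c 0.
  by rewrite !scale0r; apply: (addrI (oremul 0 g)); rewrite -oremulDl !addr0.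
by rewrite /oremul msuppMCX // big_seq1 mcoeffZ mcoeffX eqxx mulr1.
Qed.

Lemma oremulDr f : {morph oremul f : g1 g2 / g1 + g2}.
Proof.
move=> g1 g2; rewrite /oremul -big_split; apply: eq_bigr => t _ /=.
by rewrite oreTD scalerDr.
Qed.

Lemma oremulZl c f g : c *: oremul f g = oremul (c *: f) g.
Proof.
move: f; apply: mpoly_ext => [f1 f2|f1 f2|d t].
- by rewrite oremulDl scalerDr.
- by rewrite scalerDr oremulDl.
by rewrite scalerA !oremulX scalerA.
Qed.

Lemma oremulY i f g : oremul (oreY i f) g = oreY i (oremul f g).
Proof.
move: f; apply: mpoly_ext => [f1 f2|f1 f2|c t].
- by rewrite oreYD oremulDl.
- by rewrite oremulDl oreYD.
by rewrite oreYX oremulDl !oremulX oreYZ oreTU.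
Qed.

Lemma oremulA : associative oremul.
Proof.
move=> f g h; move: f; apply: mpoly_ext => [f1 f2|f1 f2|c t].
- by rewrite oremulDl.
- by rewrite !oremulDl.
rewrite !oremulX -oremulZl; congr (_ *: _).
elim/mnm_Uind: t => [|i t IH]; first by rewrite !oreT0.
by rewrite !oreTU oremulY IH.
Qed.

Lemma oremul1l : left_id 1 oremul.
Proof. by move=> f; rewrite -[1]scale1r -mpolyX0 oremulX oreT0 scale1r. Qed.

Lemma oremul1r : right_id 1 oremul.
Proof.
apply: mpoly_ext => [f1 f2|//|c t]; first by rewrite oremulDl.
by rewrite oremulX -mpolyX0 oreTX addm0.
Qed.
End OreMul.

(* The Ore extension R[Y_1; alpha_1, delta_1] ... [Y_n; alpha_n, delta_n]. *)
Definition ore (R : nzRingType) (n : nat) (D : ore_data R n) : Type :=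
  {mpoly R[n]}.

Section OreRing.
Variables (R : nzRingType) (n : nat) (D : ore_data R n).

HB.instance Definition _ := GRing.Lmodule.copy (ore D) {mpoly R[n]}.

Fact ore_mulDl : left_distributive (@oremul _ _ D) +%R.
Proof. by move=> f1 f2 g; rewrite oremulDl. Qed.

Fact ore_mulDr : right_distributive (@oremul _ _ D) +%R.
Proof. by move=> f g1 g2; rewrite oremulDr. Qed.

HB.instance Definition _ := GRing.Zmodule_isNzRing.Build (ore D)
  (@oremulA _ _ D) (@oremul1l _ _ D) (@oremul1r _ _ D) ore_mulDl ore_mulDr
  (oner_neq0 {mpoly R[n]}).

HB.instance Definition _ := GRing.Lmodule_isLalgebra.Build R (ore D)
  (@oremulZl _ _ D).

Lemma ore_lmonE r t (f : ore D) :
  (r *: 'X_[t] : ore D) * f = r *: (oreT D t f : ore D).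
Proof. exact: oremulX. Qed.

Lemma oreYr i r : ('X_i : ore D) * r%:A
  = oalpha D i r *: ('X_i : ore D) + (odelta D i r)%:A.
Proof.
rewrite -['X_i : ore D]scale1r ore_lmonE !scale1r.
rewrite -[U_(i)%MM]addm0 oreTU oreT0.
by have /= := oreYX D i r 0%MM; rewrite mpolyX0.
Qed.

Lemma oreXX s t : ('X_[s] : ore D) * ('X_[t] : ore D) = 'X_[s + t].
Proof. by rewrite -['X_[s] : ore D]scale1r ore_lmonE !scale1r; apply: oreTX. Qed.
End OreRing.

(* The data of the associated graded Ore extension R[Y_1; alpha_1] ... [Y_n;
   alpha_n].  Note that ore D and ore (graded D) are convertible as left
   R-modules but not as rings. *)
Definition graded (R : nzRingType) (n : nat) (D : ore_data R n) :
  ore_data R n.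
Proof.
refine (@OreData R n (oalpha D) (fun _ => \0 : {additive R -> R})
  (oalpha_inj (o := D)) _ _ (@oalphaC _ _ D) _) => //=.
- by move=> i r s; rewrite mulr0 mul0r addr0.
- by move=> i j _ r; rewrite raddf0.
Defined.

(* The endomorphism alpha_tau. *)
Definition oalphaT (R : nzRingType) n (D : ore_data R n) (t : 'X_{1..n}) :
  R -> R := mnm_iter (oalpha D) t.

Lemma graded_mul (R : nzRingType) n (D : ore_data R n) (a b : R) s t :
  (a *: 'X_[s] : ore (graded D)) * (b *: 'X_[t])
  = (a * oalphaT D s b) *: 'X_[s + t].
Proof.
rewrite ore_lmonE -scalerA; congr (_ *: _).
elim/mnm_Uind: s => [|i s IH].
  by rewrite oreT0 /oalphaT mnm_iter0 add0m.
rewrite oreTU IH oreYX scale0r addr0 addmA.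
by rewrite /oalphaT mnm_iterU // => *; apply: oalphaC.
Qed.


(* V (x)_C W for left R-modules V, W and a set C of scalars, as the quotient of
   the free abelian group on V * W by the bilinearity relations. *)
Section Tensor.
Variables (R : nzRingType) (C : set R) (V W : lmodType R).

Inductive tens_rel : {freeg (V * W)%type / int} -> Prop :=
| TensRel0 : tens_rel 0
| TensRelB x y : tens_rel x -> tens_rel y -> tens_rel (x - y)
| TensRelDl v1 v2 w :
    tens_rel (<< (v1 + v2, w) >> - << (v1, w) >> - << (v2, w) >>)
| TensRelDr v w1 w2 :
    tens_rel (<< (v, w1 + w2) >> - << (v, w1) >> - << (v, w2) >>)
| TensRelZ c v w : C c -> tens_rel (<< (c *: v, w) >> - << (v, c *: w) >>).

Definition tens_pred : {pred {freeg (V * W)%type / int}} :=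
  fun x => `[< tens_rel x >].

Fact tens_pred_zmod : zmod_closed tens_pred.
Proof.
split; first by apply/asboolP; apply: TensRel0.
by move=> x y /asboolP Hx /asboolP Hy; apply/asboolP; apply: TensRelB.
Qed.
HB.instance Definition _ := GRing.isZmodClosed.Build _ tens_pred tens_pred_zmod.

Local Notation Q := (Quotient.quot tens_pred).
Definition tensor : zmodType := Q.

Definition tens (v : V) (w : W) : tensor := \pi_Q << (v, w) >>.

Section Lift.
Variables (G : zmodType) (phi : V -> W -> G).

Definition balanced := [/\
  forall v1 v2 w, phi (v1 + v2) w = phi v1 w + phi v2 w,
  forall v w1 w2, phi v (w1 + w2) = phi v w1 + phi v w2 &
  forall c v w, C c -> phi (c *: v) w = phi v (c *: w)].

(* The additive map tensor -> G sending v (x) w to phi v w.  It is computed on a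
   representative, hence meaningful for balanced phi only: see tlift_tens. *)
Definition tlift (x : tensor) : G :=
  let D : {freeg (V * W)%type / int} := repr x in
  \sum_(p <- dom D) phi p.1 p.2 *~ coeff p D.

Hypothesis phi_bal : balanced.

Let ev (D : {freeg (V * W)%type / int}) : G :=
  fglift (fun p => phi p.1 p.2 : zmodule G) D.

Let evU p : ev << p >> = phi p.1 p.2.
Proof. by rewrite /ev liftU scale1r. Qed.

Let evB : {morph ev : x y / x - y}.
Proof.
move=> x y.
exact: (@fgliftB int (V * W)%type (zmodule G) (fun p => phi p.1 p.2) x y).
Qed.

Let ev_pi D : tlift (\pi_Q D) = ev D.
Proof.
rewrite /tlift; set D' := repr _.
have -> : \sum_(p <- dom D') phi p.1 p.2 *~ coeff p D' = ev D'.
  rewrite /ev -[in RHS](freeg_sumE D')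
     (big_morph _ (@fgliftD _ _ _ _) (@fglift0 _ _ _ _)).
  by apply: eq_bigr => p _; rewrite liftU.
apply/eqP; rewrite -subr_eq0 -evB.
have : D' - D \in tens_pred.
  by rewrite Quotient.idealrBE reprK.
rewrite unfold_in => /asboolP; move: (_ - _) => x.
case: phi_bal => bDl bDr bZ.
elim=> {x} [|x y _ /eqP IHx _ /eqP IHy|v1 v2 w|v w1 w2|c v w Cc].
- by rewrite /ev fglift0.
- by rewrite evB IHx IHy subrr.
- by rewrite !evB !evU /= bDl addrAC addrK subrr.
- by rewrite !evB !evU /= bDr addrAC addrK subrr.
by rewrite !evB !evU /= bZ ?subrr.
Qed.

Lemma tlift_tens v w : tlift (tens v w) = phi v w.
Proof. by rewrite ev_pi evU. Qed.

Lemma tliftB : {morph tlift : x y / x - y}.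
Proof.
move=> x y; rewrite -[x]reprK -[y]reprK.
have -> : \pi_Q (repr x) - \pi_Q (repr y)
   = \pi_Q (repr x - repr y) by rewrite !piE.
by rewrite !ev_pi evB.
Qed.
End Lift.

Lemma tens_balanced : balanced tens.
Proof.
have E x y : tens_rel (x - y) ->
    \pi_Q x = \pi_Q y.
  by move=> xy; apply/eqP; rewrite -Quotient.idealrBE; apply/asboolP.
have D x y : \pi_Q x + \pi_Q y
   = \pi_Q (x + y) by rewrite !piE.
split=> *; rewrite /tens ?D; apply: E.
- by rewrite opprD addrA; apply: TensRelDl.
- by rewrite opprD addrA; apply: TensRelDr.
exact: TensRelZ.
Qed.
End Tensor.


(* The additive subgroup of all finite sums of l x r with x in X; since A has a
   unit, this is the bilateral submodule generated by X. *)
Definition bispan (A : nzRingType) (M : zmodType) (act : A -> M -> A -> M)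
    (X : set M) : set M :=
  [set z | exists (k : nat) (l r : 'I_k -> A) (x : 'I_k -> M),
    (forall i, X (x i)) /\ z = \sum_(i < k) act (l i) (x i) (r i)].

Notation mvec R n m := {ffun 'I_m -> {mpoly R[n]}}.

Definition vact (R : nzRingType) n m (E : ore_data R n)
    (l : ore E) (f : mvec R n m) (r : ore E) :
  mvec R n m := [ffun i => l * (f i : ore E) * r].


Definition well_order (T : eqType) (r : rel T) : Prop :=
  [/\ irreflexive r, transitive r, (forall x y, x != y -> r x y || r y x)
    & well_founded (fun x y => r x y)].

Definition term_order n (prec : rel 'X_{1..n}) : Prop :=
  well_order prec /\
  forall w s t, prec s t -> prec (w + s)%MM (w + t)%MM.

(* The term t e_i is represented by the pair (t, i). *)
Notation mterm n m := ('X_{1..n} * 'I_m)%type.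

Definition mshift n m (w : 'X_{1..n}) (x : mterm n m) : mterm n m :=
  ((w + x.1)%MM, x.2).

Definition module_term_order n m (prec : rel 'X_{1..n})
    (lt : rel (mterm n m)) : Prop :=
  [/\ well_order lt,
      forall w1 w2 x, prec w1 w2 -> lt (mshift w1 x) (mshift w2 x)
    & forall w x y, lt x y -> lt (mshift w x) (mshift w y)].

Section Leading.
Variables (R : nzRingType) (n m : nat) (lt : rel (mterm n m)).
Implicit Type f : mvec R n m.

Definition msupport f : seq (mterm n m) :=
  [seq (t, i) | i <- enum 'I_m, t <- msupp (f i)].

(* None exactly when f = 0. *)
Definition lterm f : option (mterm n m) :=
  ohead [seq x <- msupport f |
         all (fun y => (y == x) || lt y x) (msupport f)].

Definition lmon f : mvec R n m :=
  if lterm f is Some x then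
    [ffun i => if i == x.2 then (f i)@_(x.1) *: 'X_[x.1] else 0]
  else 0.
End Leading.


(* T(g_l) multiplied by lam on the left and by rho on the right. *)
Definition tdeg (R : nzRingType) n m u (lt : rel (mterm n m))
    (g : 'I_u -> mvec R n m) (lam : 'X_{1..n}) (l : 'I_u) (rho : 'X_{1..n}) :
    option (mterm n m) :=
  omap (fun x => ((lam + x.1 + rho)%MM, x.2)) (lterm lt (g l)).

Definition bilateral_groebner (R : nzRingType) n m u (D : ore_data R n)
    (lt : rel (mterm n m)) (g : 'I_u -> mvec R n m) : Prop :=
  forall f, f != 0 -> bispan (@vact R n m D) (range g) f ->
  exists (k : nat) (a b : 'I_k -> R) (lam rho : 'I_k -> 'X_{1..n})
      (l : 'I_k -> 'I_u),
    (forall i, [/\ a i != 0, b i != 0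
                 & tdeg lt g (lam i) (l i) (rho i) = lterm lt f])
    /\ lmon lt f = \sum_(i < k)
         vact (a i *: 'X_[lam i] : ore (graded D)) (lmon lt (g (l i)))
              (b i *: 'X_[rho i]).


(* The constants that are central in ore D. *)
Definition ohat (R : nzRingType) n (D : ore_data R n) : set R :=
  [set a | forall h : ore D, a%:A * h = h * a%:A].

Lemma ohat_graded (R : nzRingType) n (D : ore_data R n) :
  ohat D `<=` ohat (graded D).
Proof.
move=> a aC.
have aR r : a * r = r * a.
  have := aC (r *: 'X_[0] : ore D); rewrite mpolyX0.
  rewrite -scalerAl mul1r -scalerAl mul1r !scalerA => /(congr1 (mcoeff 0%MM)).
  by rewrite !mcoeffZ mcoeff1 eqxx !mulr1.
have aA i : oalpha D i a = a.
  have := aC ('X_i : ore D); rewrite oreYr -scalerAl mul1r.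
  move=> /(congr1 (mcoeff U_(i)%MM)).
  rewrite mcoeffD !mcoeffZ mcoeffXU eqxx !mulr1 mcoeff1 mnm1_eq0 mulr0 addr0.
  by move=> <-.
have aT t : oalphaT D t a = a.
  elim/mnm_Uind: t => [|i t IH]; rewrite /oalphaT ?mnm_iter0 //.
  by rewrite mnm_iterU -/(oalphaT D t a) ?IH // => *; apply: oalphaC.
apply: mpoly_ext => [f1 f2|f1 f2|r t].
- exact: mulrDr.
- exact: mulrDl.
have X0 : (a%:A : ore (graded D)) = a *: ('X_[0] : {mpoly R[n]}).
  by rewrite mpolyX0.
by rewrite X0 !graded_mul aT add0m addm0 /oalphaT mnm_iter0 aR.
Qed.

Lemma ohat_scaleAr (R : nzRingType) n (E : ore_data R n) c (f h : ore E) :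
  ohat E c -> f * (c *: h) = c *: (f * h).
Proof.
move=> Ec; rewrite -[h in LHS]mul1r scalerAl mulrA -Ec.
by rewrite -mulrA -scalerAl mul1r.
Qed.

Section Syzygies.
Variables (R : nzRingType) (n : nat) (D : ore_data R n).

(* The tensor product over ohat of the Ore extension with its opposite.  Only
   the left R-module structure of the factors matters: a constant in ohat is
   central, so its action on either side of either factor is *:.  Hence the same
   group serves for ore D and for ore (graded D). *)
Definition otens : zmodType :=
  tensor (ohat D) {mpoly R[n]} {mpoly R[n]}.

Variable u : nat.
Implicit Type s : {ffun 'I_u -> otens}.

(* l (f e_i h) r = (l f) e_i (h r), the products being those of ore E, for E
   either D or graded D. *)
Definition sact (E : ore_data R n) (l : ore E) s (r : ore E) :
  {ffun 'I_u -> otens} :=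
  [ffun i => tlift (fun f h => tens (ohat D) (oremul E l f) (oremul E h r)) (s i)].

Lemma sact_balanced (E : ore_data R n) (l r : ore E) : ohat D `<=` ohat E ->
  balanced (ohat D) (fun f h => tens (ohat D) (oremul E l f) (oremul E h r)).
Proof.
move=> DE; have [bDl bDr bZ] := tens_balanced (ohat D) {mpoly R[n]} {mpoly R[n]}.
split=> [f1 f2 h|f h1 h2|c f h Dc].
- by rewrite oremulDr bDl.
- by rewrite oremulDl bDr.
rewrite -oremulZl -bZ //; congr tens.
exact: (@ohat_scaleAr R n E c l f (DE _ Dc)).
Qed.

(* f e_i h |-> f G_i h, the products being those of ore E. *)
Definition symap (m : nat) (E : ore_data R n) (G : 'I_u -> mvec R n m) s :
  mvec R n m :=
  \sum_i tlift (fun f h => vact (f : ore E) (G i) h) (s i).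

Lemma symap_balanced m (E : ore_data R n) (G : mvec R n m) :
  ohat D `<=` ohat E -> balanced (ohat D) (fun f h => vact (f : ore E) G h).
Proof.
move=> DE; split=> [f1 f2 h|f h1 h2|c f h Dc]; apply/ffunP => i; rewrite !ffunE.
- by rewrite -[LHS]/(oremul E (oremul E (f1 + f2) (G i)) h) !oremulDl.
- by rewrite -[LHS]/(oremul E (oremul E f (G i)) (h1 + h2)) oremulDr.
rewrite -[LHS]/(oremul E (oremul E (c *: f) (G i)) h) -!oremulZl.
exact/esym/(@ohat_scaleAr R n E c (f * (G i : ore E) : ore E) h (DE _ Dc)).
Qed.

Variables (m : nat) (lt : rel (mterm n m)) (g : 'I_u -> mvec R n m).

Definition syzS2 s : mvec R n m := symap D g s.
Definition syzs2 s : mvec R n m := symap (graded D) (fun i => lmon lt (g i)) s.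

(* The projection f (x) h |-> (f_lam lam) (x) (h_rho rho) onto the component
   spanned by the a lam (x) b rho. *)
Definition tcomp (lam rho : 'X_{1..n}) (x : otens) : otens :=
  tlift (fun f h => tens (ohat D) (f@_lam *: 'X_[lam]) (h@_rho *: 'X_[rho])) x.

Lemma tcomp_balanced (lam rho : 'X_{1..n}) : balanced (ohat D)
  (fun f h : {mpoly R[n]} => tens (ohat D) (f@_lam *: 'X_[lam]) (h@_rho *: 'X_[rho])).
Proof.
have [bDl bDr bZ] := tens_balanced (ohat D) {mpoly R[n]} {mpoly R[n]}.
split=> [f1 f2 h|f h1 h2|c f h Dc].
- by rewrite mcoeffD scalerDl bDl.
- by rewrite mcoeffD scalerDl bDr.
by rewrite !mcoeffZ -!scalerA bZ.
Qed.

(* The sum of the components of degree v.  If lam o T(g_l) o rho = v, then lam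
   and rho divide the monomial v.1, so the range below is exhaustive. *)
Definition hpart (v : mterm n m) s : {ffun 'I_u -> otens} :=
  [ffun l => \sum_(lam : 'X_{1..n < (mdeg v.1).+1})
             \sum_(rho : 'X_{1..n < (mdeg v.1).+1}
                   | tdeg lt g lam l rho == Some v) tcomp lam rho (s l)].

Definition has_maxdeg s (v : mterm n m) : Prop :=
  (exists lam l rho, tdeg lt g lam l rho = Some v /\ tcomp lam rho (s l) != 0)
  /\ (forall lam l rho w, tdeg lt g lam l rho = Some w ->
        tcomp lam rho (s l) != 0 -> w = v \/ lt w v).

(* The leading form: hpart v s for the unique v with has_maxdeg s v (and 0 for
   s = 0, which has no such v). *)
Definition lform s : {ffun 'I_u -> otens} :=
  xget 0 [set hpart v s | v in [set v | has_maxdeg s v]].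

Definition gebauer_moeller (GM : set {ffun 'I_u -> otens}) : Prop :=
  (forall s, GM s -> s != 0 /\ lform s = s) /\
  bispan (@sact (graded D)) GM = [set s | syzs2 s = 0].

Definition is_lifting s U : Prop := syzS2 U = 0 /\ lform U = s.

Definition standard_basis (B N : set {ffun 'I_u -> otens}) : Prop :=
  B `<=` N /\
  bispan (@sact (graded D)) [set lform b | b in B `\ 0]
  = bispan (@sact (graded D)) [set lform h | h in N `\ 0].
End Syzygies.

(* Main.v *)
(* The leading terms of a product f * g * h in the Ore extension and in the
   associated graded one agree, the difference lying in strictly smaller terms.
   Hence for a syzygy s whose components have degree at most v, S_2(s) differs
   from s_2 of the degree v part of s by terms smaller than v.  In particular
   the leading form of an element of ker S_2 lies in ker s_2, which is generated
   by GM; and for a homogeneous s in ker s_2 of degree v all terms of S_2(s) are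
   smaller than v, so that a Groebner representation of S_2(s) provides an h with
   components of degree smaller than v and S_2(h) = S_2(s): the difference s - h
   is a lifting of s. *)

Require Import Defs.
From HB Require Import structures.
From mathcomp Require Import all_boot all_order all_algebra.
From mathcomp Require Import generic_quotient ring_quotient.
From mathcomp Require Import boolp classical_sets.
From mathcomp Require Import freeg mpoly.

Set Implicit Arguments.
Unset Strict Implicit.
Unset Printing Implicit Defensive.

Import GRing.Theory.
Local Open Scope ring_scope.
Local Open Scope quotient_scope.
Local Open Scope classical_set_scope.

(** * Maps between additive groups that respect subtraction *)

Section MorphB.
Variables (U V : zmodType) (F : U -> V).
Hypothesis FB : {morph F : x y / x - y}.

Lemma morphB0 : F 0 = 0.
Proof. by rewrite -(subrr 0) FB subrr. Qed.

Lemma morphBN : {morph F : x / - x}.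
Proof. by move=> x; rewrite -sub0r FB morphB0 sub0r. Qed.

Lemma morphBD : {morph F : x y / x + y}.
Proof. by move=> x y; rewrite -{1}[y]opprK FB morphBN opprK. Qed.

Lemma morphB_sum I r (P : pred I) G :
  F (\sum_(i <- r | P i) G i) = \sum_(i <- r | P i) F (G i).
Proof. exact: (big_morph F morphBD morphB0). Qed.
End MorphB.

(** * Induction and extensionality for tensor products *)

Section TensorTheory.
Variables (R : nzRingType) (C : set R) (V W : lmodType R).

(** Every class is represented by an integer combination of pairs, hence is an integer combination
    of pure tensors; closure under 0 and subtraction already gives closure under all such
    combinations. *)
Lemma tensor_ind (P : tensor C V W -> Prop) :
    P 0 -> (forall x y, P x -> P y -> P (x - y)) ->
    (forall v w, P (tens C v w)) ->
  forall x, P x.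
Proof.
move=> P0 PB Pt x.
have PD y z : P y -> P z -> P (y + z).
  by move=> Py Pz; rewrite -[z]opprK -[- z]sub0r; apply/PB/PB.
have PM y (k : int) : P y -> P (y *~ k).
  move=> Py; have PMn i : P (y *+ i).
    by elim: i => [|i IHi]; rewrite ?mulr0n // mulrS; apply: PD.
  case: k => i; first exact: PMn.
  by rewrite NegzE mulrNz -[- _]sub0r; apply: PB => //; apply: PMn.
pose pi d : tensor C V W := \pi_(Quotient.quot (tens_pred C (W := W))) d.
have piB : {morph pi : d e / d - e} by move=> d e; rewrite /pi !piE.
have {1}-> : x = pi (repr x) by rewrite /pi reprK.
rewrite -[repr x]freeg_sumE (morphB_sum piB).
elim: (dom _) => [|p r IH]; first by rewrite big_nil.
rewrite big_cons; apply: (PD _ _ _ IH).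
have -> k : pi << k *g p >> = tens C p.1 p.2 *~ k.
  (* The quotient map is packed as an additive morphism on the spot, so that it commutes with
     integer multiples. *)
  rewrite -[k in LHS]intz -freegU_mulz.
  by rewrite -(raddfMz (HB.pack_for {additive _ -> _} pi
       (GRing.isZmodMorphism.Build _ _ pi piB))) -surjective_pairing.
exact: PM.
Qed.

Lemma tensor_ext (G : zmodType) (F1 F2 : tensor C V W -> G) :
    {morph F1 : x y / x - y} -> {morph F2 : x y / x - y} ->
  (forall v w, F1 (tens C v w) = F2 (tens C v w)) -> F1 =1 F2.
Proof.
move=> F1B F2B E; apply: tensor_ind => //; first by rewrite !morphB0.
by move=> x y Ex Ey; rewrite F1B F2B Ex Ey.
Qed.

Section Balanced.
Variables (G : zmodType) (phi : V -> W -> G).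
Hypothesis phi_bal : balanced C phi.

Lemma balancedBl w : {morph phi^~ w : v1 v2 / v1 - v2}.
Proof.
case: phi_bal => D _ _ v1 v2; apply/(addIr (phi v2 w)).
by rewrite -D !subrK.
Qed.

Lemma balancedBr v : {morph phi v : w1 w2 / w1 - w2}.
Proof.
case: phi_bal => _ D _ w1 w2; apply/(addIr (phi v w2)).
by rewrite -D !subrK.
Qed.

Lemma balanced_suml I r (P : pred I) F w :
  phi (\sum_(i <- r | P i) F i) w = \sum_(i <- r | P i) phi (F i) w.
Proof. exact: (morphB_sum (balancedBl w)). Qed.

Lemma balanced_sumr I r (P : pred I) F v :
  phi v (\sum_(i <- r | P i) F i) = \sum_(i <- r | P i) phi v (F i).
Proof. exact: (morphB_sum (balancedBr v)). Qed.
End Balanced.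
End TensorTheory.

(** * Decomposition of the tensor product into components indexed by pairs of terms *)

Section Components.
Variables (R : nzRingType) (n : nat) (D : ore_data R n).
Implicit Types (x : otens D) (lam rho : 'X_{1..n}).

Lemma tcompB lam rho : {morph @tcomp R n D lam rho : x y / x - y}.
Proof. exact/tliftB/tcomp_balanced. Qed.

Lemma tcomp_tens lam rho f h : tcomp lam rho (tens (ohat D) f h)
  = tens (ohat D) (f@_lam *: 'X_[lam]) (h@_rho *: 'X_[rho]) :> otens D.
Proof. exact/tlift_tens/tcomp_balanced. Qed.

(** The projections are orthogonal idempotents: on pure tensors this is the extraction of
    coefficients from monomials. *)
Lemma tcomp_tcomp lam rho lam' rho' x :
  tcomp lam rho (tcomp lam' rho' x)
  = if (lam == lam') && (rho == rho') then tcomp lam' rho' x else 0.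
Proof.
move: x; apply: tensor_ext => [x y|x y|f h].
- by rewrite !tcompB.
- by case: ifP => _; rewrite ?tcompB ?subr0.
rewrite !tcomp_tens !mcoeffZ !mcoeffX.
have T := tens_balanced (ohat D) {mpoly R[n]} {mpoly R[n]}.
rewrite [lam' == _]eq_sym [rho' == _]eq_sym.
case: eqP => [->|_] /=; last by rewrite mulr0 scale0r (morphB0 (balancedBl T _)).
case: eqP => [->|_] /=; first by rewrite !mulr1.
by rewrite mulr0 scale0r (morphB0 (balancedBr T _)).
Qed.

(** The identity is stated for all large [k], not for one bound, so that the decompositions of two
    elements can be taken over the same range. *)
Lemma tcomp_decomp x : exists N, forall k, (N <= k)%N ->
  x = \sum_(lam : 'X_{1..n < k}) \sum_(rho : 'X_{1..n < k}) tcomp lam rho x.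
Proof.
have T := tens_balanced (ohat D) {mpoly R[n]} {mpoly R[n]}.
move: x; apply: tensor_ind => [|x y [Nx Ex] [Ny Ey]|f h].
- exists 0%N => k _; rewrite big1 // => lam _; rewrite big1 // => rho _.
  exact: morphB0 (tcompB _ _).
- exists (maxn Nx Ny) => k; rewrite geq_max => /andP[/Ex kx /Ey ky].
  rewrite {1}kx {1}ky -sumrB; apply: eq_bigr => lam _.
  by rewrite -sumrB; apply: eq_bigr => rho _; rewrite tcompB.
exists (maxn (msize f) (msize h)) => k; rewrite geq_max => /andP[kf kh].
rewrite {1}(mpolywE kf) (balanced_suml T); apply: eq_bigr => lam _.
rewrite {1}(mpolywE kh) (balanced_sumr T); apply: eq_bigr => rho _.
by rewrite tcomp_tens.
Qed.

(** An element has finitely many nonzero components: a projection applied to the finite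
    decomposition vanishes, by orthogonality, unless its index occurs there. *)
Lemma tcomp_bounded x : exists N, forall lam rho,
  tcomp lam rho x != 0 -> (mdeg lam < N)%N /\ (mdeg rho < N)%N.
Proof.
have [N /(_ N (leqnn N)) E] := tcomp_decomp x; exists N => lam rho.
rewrite [X in tcomp _ _ X]E (morphB_sum (tcompB _ _)) => nz.
case: (boolP ((mdeg lam < N)%N && (mdeg rho < N)%N)) => [/andP //|lt].
case/eqP: nz; rewrite big1 // => lam' _.
rewrite (morphB_sum (tcompB _ _)) big1 // => rho' _; rewrite tcomp_tcomp.
case: ifP => // /andP[/eqP el /eqP er]; case/negP: lt.
by rewrite el er !bmdeg.
Qed.

Lemma tcomp_eq0 x : (forall lam rho, tcomp lam rho x = 0) -> x = 0.
Proof.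
move=> x0; have [N /(_ N (leqnn N)) ->] := tcomp_decomp x.
by rewrite big1 // => lam _; rewrite big1.
Qed.
End Components.

(** * Term orders, and the terms of products in an Ore extension and in its graded ring *)

Section Terms.
Variables (n : nat) (prec : rel 'X_{1..n}).
Hypothesis prec_order : term_order prec.

Definition preceq s t := (s == t) || prec s t.

Lemma prec_trans : transitive prec.
Proof. by case: prec_order => -[]. Qed.

Lemma prec_add2l w s t : prec s t -> prec (w + s)%MM (w + t)%MM.
Proof. by case: prec_order => _; apply. Qed.

Lemma prec_add2r w s t : prec s t -> prec (s + w)%MM (t + w)%MM.
Proof. by rewrite ![(_ + w)%MM]addmC; apply: prec_add2l. Qed.

Lemma preceq_add2l w s t : preceq s t -> preceq (w + s)%MM (w + t)%MM.
Proof.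
case/predU1P => [->|/(prec_add2l w)]; rewrite /preceq ?eqxx // => ->.
exact: orbT.
Qed.

Lemma preceq_add2r w s t : preceq s t -> preceq (s + w)%MM (t + w)%MM.
Proof. by rewrite ![(_ + w)%MM]addmC; apply: preceq_add2l. Qed.

Lemma prec_le_trans t s r : prec s t -> preceq t r -> prec s r.
Proof. by move=> st /predU1P[<- //|]; apply: prec_trans. Qed.

Lemma preceq_lt_trans t s r : preceq s t -> prec t r -> prec s r.
Proof. by move=> /predU1P[-> //|] st; apply: prec_trans. Qed.

Lemma preceq_trans : transitive preceq.
Proof.
move=> t s r /predU1P[-> //|st] tr.
by apply/orP; right; apply: prec_le_trans tr.
Qed.

(* A term t < 1 would give the infinite descent 1 > t > t^2 > ... *)
Lemma prec_ge1 t : preceq 0%MM t.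
Proof.
case: prec_order => -[_ _ tot wf] _; rewrite /preceq.
case: eqVneq => //= /tot /orP[// | t0].
suff desc s k : (k = t *+ s)%MM -> False by case: (desc 0%N 0%MM); rewrite mulm0n.
elim/(well_founded_induction wf): k s => k IH s def_k.
apply: (IH (t *+ s.+1)%MM _ s.+1) => //.
by rewrite def_k mulmS; have := prec_add2r (t *+ s)%MM t0; rewrite add0m.
Qed.

Lemma preceq_addl t s : preceq s (t + s)%MM.
Proof. by have := preceq_add2r s (prec_ge1 t); rewrite add0m. Qed.

Lemma prec_addU i s : prec s (U_(i) + s)%MM.
Proof.
case/predU1P: (preceq_addl U_(i) s) => // /mnmP/(_ i)/eqP.
by rewrite mnmDE mnm1E eqxx -[X in X == _]add0n eqn_add2r.
Qed.

Variables (R : nzRingType).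
Implicit Types (f h : {mpoly R[n]}) (D E : ore_data R n).

Lemma mcoeff_sum_neq0 (I : eqType) (r : seq I) (F : I -> {mpoly R[n]}) s :
  (\sum_(i <- r) F i)@_s != 0 -> exists2 i, i \in r & (F i)@_s != 0.
Proof.
elim: r => [|i r IH]; first by rewrite big_nil mcoeff0 eqxx.
rewrite big_cons mcoeffD; have [->|nz _] := eqVneq (F i)@_s 0.
  by rewrite add0r => /IH[j jr nz]; exists j => //; rewrite inE jr orbT.
by exists i; rewrite ?mem_head.
Qed.

Lemma mcoeffB_neq0 f h s : (f - h)@_s != 0 -> f@_s != 0 \/ h@_s != 0.
Proof.
rewrite mcoeffB; have [->|] := eqVneq f@_s 0; last by left.
by rewrite sub0r oppr_eq0; right.
Qed.

Lemma mcoeffZ_neq0 c f s : (c *: f)@_s != 0 -> f@_s != 0.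
Proof. by rewrite mcoeffZ; apply: contraNneq => ->; rewrite mulr0. Qed.

Lemma mcoeffZX_neq0 (c : R) t s : (c *: 'X_[t] : {mpoly R[n]})@_s != 0 -> s = t.
Proof.
rewrite mcoeffZ mcoeffX; case: (eqVneq t s) => [-> //|_].
by rewrite mulr0 eqxx.
Qed.

(** The [odelta] part keeps the terms of [f], and the [oalpha] part multiplies them by the
    variable. *)
Lemma oreY_supp E i f s : (oreY E i f)@_s != 0 ->
  f@_s != 0 \/ exists2 t, f@_t != 0 & s = (U_(i) + t)%MM.
Proof.
rewrite {1}(mpolyE f) (big_morph _ (oreYD E i) (morphB0 _)).
  case/mcoeff_sum_neq0 => t; rewrite mcoeff_msupp oreYX mcoeffD => ft.
  have [-> | nz _] := eqVneq (oalpha E i f@_t *: 'X_[U_(i) + t])@_s 0.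
    by rewrite add0r => /mcoeffZX_neq0 ->; left.
  by right; exists t => //; apply: mcoeffZX_neq0 nz.
by move=> x y; rewrite /oreY !raddfB mulrBl opprD addrACA.
Qed.

(** Induction on [t]: a term kept by [odelta] stays below the new bound since 1 is the least term,
    and a shifted term obeys it by monotonicity. *)
Lemma oreT_supp E c t r s : (oreT E t (c *: 'X_[r]))@_s != 0 ->
  preceq s (t + r)%MM.
Proof.
elim/mnm_Uind: t s => [|i t IH] s.
  by rewrite oreT0 add0m => /mcoeffZX_neq0 ->; rewrite /preceq eqxx.
rewrite oreTU -addmA => /oreY_supp[/IH|[q /IH qtr ->]].
  by move/preceq_trans; apply; apply: preceq_addl.
exact: preceq_add2l.
Qed.

Lemma oreT0r E t : oreT E t 0 = 0.
Proof.
elim/mnm_Uind: t => [|i t IH]; first by rewrite oreT0.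
by rewrite oreTU IH /oreY !raddf0 mul0r addr0.
Qed.

Lemma oremul_sum E f h :
  oremul E f h = \sum_(t <- msupp f) \sum_(r <- msupp h)
    f@_t *: oreT E t (h@_r *: 'X_[r]).
Proof.
rewrite /oremul; apply: eq_bigr => t _.
by rewrite {1}(mpolyE h) (big_morph _ (oreTD E t) (oreT0r E t)) scaler_sumr.
Qed.

Lemma oremul_supp E f h s : (oremul E f h)@_s != 0 ->
  exists t r, [/\ f@_t != 0, h@_r != 0 & preceq s (t + r)%MM].
Proof.
rewrite oremul_sum => /mcoeff_sum_neq0[t]; rewrite mcoeff_msupp => ft.
case/mcoeff_sum_neq0 => r; rewrite mcoeff_msupp => hr /mcoeffZ_neq0/oreT_supp.
by exists t, r.
Qed.

(** Strictness comes from the derivations: they do not raise terms, whereas the bound grows by one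
    variable at each step of the induction. *)
Lemma oreT_graded_supp D c t r s :
    (oreT D t (c *: 'X_[r]) - oreT (graded D) t (c *: 'X_[r]))@_s != 0 ->
  prec s (t + r)%MM.
Proof.
elim/mnm_Uind: t s => [|i t IH] s.
  by rewrite !oreT0 subrr mcoeff0 eqxx.
rewrite !oreTU -addmA; set f := oreT D t _; set h := oreT _ t _.
have YG q : oreY (graded D) i q = map_mpoly (oalpha D i) q * 'X_i.
  rewrite /oreY -[RHS]addr0; congr (_ + _); apply/mpolyP => v.
  by rewrite mcoeff_map_mpoly mcoeff0.
(* The new error is the derivation part of [f] plus the graded multiple of the old error [f - h];
   the induction hypothesis bounds the latter. *)
have -> : oreY D i f - oreY (graded D) i h
    = map_mpoly (odelta D i) f + oreY (graded D) i (f - h).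
  by rewrite !YG raddfB mulrBl addrCA addrA.
rewrite mcoeffD; have [->|nz _] := eqVneq (map_mpoly (odelta D i) f)@_s 0.
  rewrite add0r => /oreY_supp[/IH s_lt|[q /IH q_lt ->]].
    exact: prec_le_trans s_lt (preceq_addl _ _).
  exact: prec_add2l.
apply: preceq_lt_trans (prec_addU _ _); apply: (@oreT_supp D c).
by apply: contraNneq nz; rewrite mcoeff_map_mpoly => ->; rewrite raddf0.
Qed.

Lemma oremul_graded_supp D f h s :
    (oremul D f h - oremul (graded D) f h)@_s != 0 ->
  exists t r, [/\ f@_t != 0, h@_r != 0 & prec s (t + r)%MM].
Proof.
rewrite !oremul_sum -sumrB => /mcoeff_sum_neq0[t]; rewrite mcoeff_msupp => ft.
rewrite -sumrB => /mcoeff_sum_neq0[r]; rewrite mcoeff_msupp => hr.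
rewrite -scalerBr => /mcoeffZ_neq0/oreT_graded_supp.
by exists t, r.
Qed.

Lemma oremul3_supp E f h k s : (oremul E (oremul E f h) k)@_s != 0 ->
  exists t r q, [/\ f@_t != 0, h@_r != 0, k@_q != 0 & preceq s (t + r + q)%MM].
Proof.
case/oremul_supp => p [q] [/oremul_supp[t [r [ft hr pt]]] kq sp].
exists t, r, q; split=> //; apply: preceq_trans sp _; exact: preceq_add2r.
Qed.

(** The two products are changed one at a time, through the graded product of [p] and [k]; each
    change combines one strict bound with one weak bound. *)
Lemma oremul3_graded_supp D f h k s :
    (oremul D (oremul D f h) k
     - oremul (graded D) (oremul (graded D) f h) k)@_s != 0 ->
  exists t r q, [/\ f@_t != 0, h@_r != 0, k@_q != 0 & prec s (t + r + q)%MM].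
Proof.
set G := graded D; set p := oremul D f h; set p' := oremul G f h.
have := oremulDl G k p' (p - p'); rewrite [(p' + _)]addrC subrK /= => Ep.
have -> : oremul D p k - oremul G p' k
    = (oremul D p k - oremul G p k) + oremul G (p - p') k.
  by rewrite Ep opprD !addrA subrK.
rewrite mcoeffD.
have [->|nz _] := eqVneq (oremul D p k - oremul G p k)@_s 0.
  rewrite add0r => /oremul_supp[v [q [/oremul_graded_supp[t [r [ft hr lt_v]]]]]].
  move=> kq sv; exists t, r, q; split=> //.
  by apply: preceq_lt_trans sv _; apply: prec_add2r.
have [v [q [/oremul_supp[t [r [ft hr le_v]]] kq lt_s]]] := oremul_graded_supp nz.
by exists t, r, q; split=> //; apply: prec_le_trans lt_s _; apply: preceq_add2r.
Qed.
End Terms.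

(** * Supports and leading monomials of vectors *)

Section Vectors.
Variables (R : nzRingType) (n m : nat).
Implicit Types (f h : mvec R n m) (P Q : mterm n m -> Prop).

Definition supp_in P f := forall t i, (f i)@_t != 0 -> P (t, i).

Lemma supp_in0 P : supp_in P 0.
Proof. by move=> t i; rewrite ffunE mcoeff0 eqxx. Qed.

Lemma supp_inB P f h : supp_in P f -> supp_in P h -> supp_in P (f - h).
Proof.
by move=> Pf Ph t i; rewrite !ffunE => /mcoeffB_neq0[/Pf|/Ph].
Qed.

Lemma supp_inD P f h : supp_in P f -> supp_in P h -> supp_in P (f + h).
Proof.
move=> Pf Ph; rewrite -[h]opprK -[- h]sub0r.
by do !apply: supp_inB => //; apply: supp_in0.
Qed.

Lemma supp_in_sum P I (r : seq I) (p : pred I) (F : I -> mvec R n m) :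
  (forall i, p i -> supp_in P (F i)) -> supp_in P (\sum_(i <- r | p i) F i).
Proof. by move=> PF; apply: big_ind => //; [apply: supp_in0 | apply: supp_inD]. Qed.

Lemma supp_inW P Q f : (forall x, P x -> Q x) -> supp_in P f -> supp_in Q f.
Proof. by move=> PQ Pf t i /Pf/PQ. Qed.

Lemma supp_in_eq0 f : supp_in (fun=> False) f -> f = 0.
Proof.
move=> f0; apply/ffunP => i; apply/mpolyP => t.
by rewrite ffunE mcoeff0; apply/eqP/negPn/negP => /f0.
Qed.

Lemma mem_msupport f t i : ((t, i) \in msupport f) = ((f i)@_t != 0).
Proof.
rewrite -mcoeff_msupp; apply/allpairsPdep/idP => [[i' [t' [_ ft [-> ->]]]] //|ft].
by exists i, t; rewrite mem_enum.
Qed.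

Variables (prec : rel 'X_{1..n}) (lt : rel (mterm n m)).
Hypotheses (prec_order : term_order prec) (lt_order : module_term_order prec lt).

Definition mleq x y := x = y \/ lt x y.

Lemma lt_trans : transitive lt.
Proof. by case: lt_order => -[]. Qed.

Lemma lt_nrefl x : lt x x = false.
Proof. by case: lt_order => -[]. Qed.

Lemma mleq_lt_trans y x z : mleq x y -> lt y z -> lt x z.
Proof. by case=> [-> //|]; apply: lt_trans. Qed.

Lemma mleq_total x y : mleq x y \/ lt y x.
Proof.
have [->|xy] := eqVneq x y; first by left; left.
case: lt_order => -[_ _ tot _] _ _.
by have /orP[] := tot x y xy; [left; right | right].
Qed.

Lemma lt_prec s t i : prec s t -> lt (s, i) (t, i).
Proof.
case: lt_order => _ pl _ /(pl _ _ (0%MM, i)).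
by rewrite /mshift /= !addm0.
Qed.

Lemma mleq_preceq s t i : preceq prec s t -> mleq (s, i) (t, i).
Proof. by case/predU1P => [->|/lt_prec]; [left | right]. Qed.

(** Terms commute, so multiplying on both sides amounts to a left shift by [lam + rho]. *)
Lemma lt_shift lam rho x y :
  lt x y -> lt ((lam + x.1 + rho)%MM, x.2) ((lam + y.1 + rho)%MM, y.2).
Proof.
case: lt_order => _ _ sh /(sh (lam + rho)%MM); rewrite /mshift.
by rewrite -!addmA ![(rho + _)%MM]addmC.
Qed.

(** The key [F] lets one statement serve both the terms of a vector and the degrees of the
    components of a syzygy. *)
Lemma seq_max (T : eqType) (s : seq T) (F : T -> mterm n m) : s != [::] ->
  exists2 x, x \in s & forall y, y \in s -> mleq (F y) (F x).
Proof.
elim: s => // x [_ _|y s /(_ isT)[z zs zmax] _].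
  by exists x => [|y]; rewrite !inE ?eqxx // => /eqP ->; left.
have [xz|zx] := mleq_total (F x) (F z).
  exists z => [|t]; rewrite inE ?zs ?orbT //.
  by case/predU1P=> [->|/zmax].
exists x => [|t]; rewrite inE ?eqxx // => /predU1P[->|/zmax tz]; first by left.
by right; apply: mleq_lt_trans tz zx.
Qed.

Lemma ltermP f x : lterm lt f = Some x ->
  (f x.2)@_x.1 != 0 /\ supp_in (mleq^~ x) f.
Proof.
rewrite /lterm => E.
have : x \in [seq x <- msupport f | all (fun y => (y == x) || lt y x) (msupport f)].
  by case: filter E => //= y r [->]; rewrite mem_head.
rewrite mem_filter => /andP[/allP xmax]; rewrite -mem_msupport -surjective_pairing.
split=> // t i; rewrite -mem_msupport => /xmax /predU1P[]; by [left | right].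
Qed.

Lemma lterm_exists f : f != 0 -> exists x, lterm lt f = Some x.
Proof.
move=> f0; have : msupport f != [::].
  apply: contra_neq f0 => s0; apply/ffunP => i; apply/mpolyP => t.
  by rewrite ffunE mcoeff0; apply/eqP; rewrite -[_ == _]negbK -mem_msupport s0.
case/(@seq_max _ _ id) => x xs xmax; rewrite /lterm.
have : x \in [seq x <- msupport f | all (fun y => (y == x) || lt y x) (msupport f)].
  rewrite mem_filter xs andbT; apply/allP => y /xmax[->|->]; first by rewrite eqxx.
  by rewrite orbT.
by case: filter => // y r _; exists y.
Qed.

Lemma lmonE f x i : lterm lt f = Some x ->
  lmon lt f i = if i == x.2 then (f i)@_x.1 *: 'X_[x.1] else 0.
Proof. by rewrite /lmon => ->; rewrite ffunE. Qed.

Lemma supp_lmon f x : lterm lt f = Some x -> supp_in (eq^~ x) (lmon lt f).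
Proof.
move=> fx t i; rewrite (lmonE i fx); case: (eqVneq i x.2) => [->|_].
  by move=> /mcoeffZX_neq0 ->; rewrite -surjective_pairing.
by rewrite mcoeff0 eqxx.
Qed.

Lemma supp_sub_lmon f x : lterm lt f = Some x -> supp_in (lt^~ x) (f - lmon lt f).
Proof.
move=> fx t i; have [_ fle] := ltermP fx; rewrite 2!ffunE (lmonE i fx).
have [eq_i|ne_i] := eqVneq i x.2; last first.
  by rewrite subr0 => /fle[E|//]; case/eqP: ne_i; rewrite -E.
rewrite mcoeffB mcoeffZ mcoeffX; case: (eqVneq x.1 t) => [<-|ne_t].
  by rewrite mulr1 eq_i subrr eqxx.
by rewrite mulr0 subr0 => /fle[E|//]; case/eqP: ne_t; rewrite -E.
Qed.

Lemma vactE (E : ore_data R n) (l r : ore E) f i :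
  vact l f r i = oremul E (oremul E l (f i)) r.
Proof. by rewrite ffunE. Qed.

Lemma vactB (E : ore_data R n) (l r : ore E) :
  {morph (fun f => vact l f r) : f h / f - h}.
Proof.
by move=> f h; apply/ffunP => i; rewrite !ffunE mulrBr mulrBl.
Qed.

Variables (D : ore_data R n) (a b : R) (lam rho : 'X_{1..n}).
Variables (f : mvec R n m) (x : mterm n m).
Hypothesis fx : lterm lt f = Some x.

Let w : mterm n m := ((lam + x.1 + rho)%MM, x.2).

Lemma supp_vact_lmon : supp_in (eq^~ w)
  (vact (a *: 'X_[lam] : ore (graded D)) (lmon lt f) (b *: 'X_[rho])).
Proof.
move=> t i; rewrite ffunE (lmonE i fx); case: (eqVneq i x.2) => [->|_].
  by rewrite !graded_mul => /mcoeffZX_neq0 ->.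
by rewrite mulr0 mul0r mcoeff0 eqxx.
Qed.

(** Two errors add up: the tail of [f], whose terms lie below [x] and stay below [w] after
    multiplication, and the change from Ore products to graded ones on the leading monomial. *)
Lemma supp_vact_sub_lmon : supp_in (lt^~ w)
  (vact (a *: 'X_[lam] : ore D) f (b *: 'X_[rho])
   - vact (a *: 'X_[lam] : ore (graded D)) (lmon lt f) (b *: 'X_[rho])).
Proof.
rewrite -{1}[f](subrK (lmon lt f)).
rewrite (morphBD (vactB (a *: 'X_[lam] : ore D) (b *: 'X_[rho] : ore D))) -addrA.
apply: supp_inD => t i.
  rewrite vactE => /(oremul3_supp prec_order)[s [r [q []]]].
  move=> /mcoeffZX_neq0 -> /(supp_sub_lmon fx) lt_x /mcoeffZX_neq0 ->.
  by move/(@mleq_preceq _ _ i)/mleq_lt_trans; apply; apply: (lt_shift lam rho lt_x).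
rewrite !ffunE => /(oremul3_graded_supp prec_order)[s [r [q []]]].
move=> /mcoeffZX_neq0 -> /(supp_lmon fx) E /mcoeffZX_neq0 -> /lt_prec.
by rewrite /w -E; apply.
Qed.

End Vectors.

(** * Closure properties of generated bilateral submodules *)

Section Bispan.
Variables (A : nzRingType) (M : zmodType) (act : A -> M -> A -> M).
Hypothesis actB : forall l r, {morph (fun x => act l x r) : x y / x - y}.
Hypothesis actA : forall l l' x r r',
  act l (act l' x r') r = act (l * l') x (r' * r).
Hypothesis actNl : forall l x r, act (- l) x r = - act l x r.
Implicit Type X : set M.

Lemma bispan0 X : bispan act X 0.
Proof.
exists 0%N, (fun=> 0), (fun=> 0), (fun=> 0); split; first by case.
by rewrite big_ord0.
Qed.

Lemma bispanD X x y : bispan act X x -> bispan act X y -> bispan act X (x + y).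
Proof.
move=> [k1 [l1 [r1 [x1 [X1 ->]]]]] [k2 [l2 [r2 [x2 [X2 ->]]]]].
(* Concatenation of two families, used for the left factors, the right factors and the generators
   alike. *)
pose c T (f1 : 'I_k1 -> T) (f2 : 'I_k2 -> T) i :=
  match split i with inl j => f1 j | inr j => f2 j end.
exists (k1 + k2)%N, (c _ l1 l2), (c _ r1 r2), (c _ x1 x2); split.
  by move=> i; rewrite /c; case: splitP.
have cl T (f1 : 'I_k1 -> T) f2 j : c T f1 f2 (lshift k2 j) = f1 j.
  by rewrite /c; have /= -> := unsplitK (inl j : 'I_k1 + 'I_k2).
have cr T (f1 : 'I_k1 -> T) f2 j : c T f1 f2 (rshift k1 j) = f2 j.
  by rewrite /c; have /= -> := unsplitK (inr j : 'I_k1 + 'I_k2).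
by rewrite big_split_ord /=; congr (_ + _); apply: eq_bigr => j _; rewrite ?cl ?cr.
Qed.

Lemma bispanN X x : bispan act X x -> bispan act X (- x).
Proof.
move=> [k [l [r [y [Xy ->]]]]]; exists k, (fun i => - l i), r, y; split=> //.
by rewrite -sumrN; apply: eq_bigr => i _; rewrite actNl.
Qed.

Lemma bispanB X x y : bispan act X x -> bispan act X y -> bispan act X (x - y).
Proof. by move=> ? ?; apply: bispanD => //; apply: bispanN. Qed.

Lemma bispan_act X l x r : bispan act X x -> bispan act X (act l x r).
Proof.
move=> [k [l' [r' [y [Xy ->]]]]]; exists k, (fun i => l * l' i), (fun i => r' i * r), y.
split=> //; rewrite (morphB_sum (actB l r)).
by apply: eq_bigr => i _; rewrite actA.
Qed.

Lemma bispanS X Y : X `<=` Y -> bispan act X `<=` bispan act Y.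
Proof. by move=> XY z [k [l [r [x [/(_ _)/XY Xx ->]]]]]; exists k, l, r, x. Qed.

Lemma bispan_idem X : bispan act (bispan act X) `<=` bispan act X.
Proof.
move=> z [k [l [r [x [Xx ->]]]]]; apply: big_ind => //.
- exact: bispan0.
- exact: bispanD.
by move=> i _; apply: bispan_act.
Qed.
End Bispan.

(** * Syzygies: bimodule structure, degrees, leading forms and liftings *)

Section SyzTheory.
Variables (R : nzRingType) (n u m : nat) (D : ore_data R n).
Implicit Type s : {ffun 'I_u -> otens D}.

Section Sact.
Variable E : ore_data R n.
Hypothesis DE : ohat D `<=` ohat E.

Lemma sactB (l r : ore E) : {morph (fun s => sact l s r) : s1 s2 / s1 - s2}.
Proof.
by move=> s1 s2; apply/ffunP => i; rewrite !ffunE; apply/tliftB/sact_balanced.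
Qed.

Lemma sactA (l l' : ore E) s (r r' : ore E) :
  sact l (sact l' s r') r = sact (l * l') s (r' * r).
Proof.
apply/ffunP => i; rewrite !ffunE; move: (s i).
have B1 := tliftB (sact_balanced l r DE).
have B2 := tliftB (sact_balanced l' r' DE).
apply: tensor_ext => [x y|x y|f h].
- by rewrite B2 B1.
- exact/tliftB/sact_balanced.
by rewrite !tlift_tens; [rewrite !oremulA | exact: sact_balanced..].
Qed.

Lemma sact1 s : sact (1 : ore E) s (1 : ore E) = s.
Proof.
have B := tliftB (sact_balanced (1 : ore E) (1 : ore E) DE).
apply/ffunP => i; rewrite ffunE; move: (s i); apply: tensor_ext => // f h.
by rewrite tlift_tens ?oremul1l ?oremul1r //; apply: sact_balanced.
Qed.

Definition tvact (f : mvec R n m) : otens D -> mvec R n m :=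
  tlift (fun h k => vact (h : ore E) f k).

Lemma tvactB f : {morph tvact f : x y / x - y}.
Proof. exact/tliftB/symap_balanced. Qed.

Lemma tvact_tens f h k : tvact f (tens (ohat D) h k) = vact (h : ore E) f k.
Proof. exact/tlift_tens/symap_balanced. Qed.

Lemma symapE (G : 'I_u -> mvec R n m) s : symap E G s = \sum_l tvact (G l) (s l).
Proof. by []. Qed.

Lemma symapB (G : 'I_u -> mvec R n m) :
  {morph @symap R n D u m E G : s1 s2 / s1 - s2}.
Proof.
move=> s1 s2; rewrite !symapE -sumrB; apply: eq_bigr => l _.
by rewrite !ffunE tvactB.
Qed.
End Sact.

Lemma tcomp_ffunB lam rho s1 s2 l :
  tcomp lam rho ((s1 - s2) l) = tcomp lam rho (s1 l) - tcomp lam rho (s2 l).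
Proof. by rewrite !ffunE tcompB. Qed.

Variables (prec : rel 'X_{1..n}) (lt : rel (mterm n m)).
Hypotheses (prec_order : term_order prec) (lt_order : module_term_order prec lt).
Variables (g : 'I_u -> mvec R n m).
Hypothesis g_neq0 : forall l, g l != 0.

Lemma tdeg_exists lam l rho : exists w, tdeg lt g lam l rho = Some w.
Proof. by have [x E] := lterm_exists lt_order (g_neq0 l); rewrite /tdeg E; eexists. Qed.

Lemma tdegP lam l rho w : tdeg lt g lam l rho = Some w ->
  exists2 x, lterm lt (g l) = Some x & w = ((lam + x.1 + rho)%MM, x.2).
Proof. by rewrite /tdeg; case: lterm => //= x [<-]; exists x. Qed.

Lemma hpartB v : {morph @hpart R n D u m lt g v : s1 s2 / s1 - s2}.
Proof.
move=> s1 s2; apply/ffunP => l; rewrite !ffunE -sumrB; apply: eq_bigr => lam _.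
by rewrite -sumrB; apply: eq_bigr => rho _; rewrite tcompB.
Qed.

(** By orthogonality only the index [(lam, rho)] can survive in the double sum; when its degree is
    [v], both terms divide [v.1], so the bounded range does contain it. *)
Lemma tcomp_hpart v s lam l rho : tcomp lam rho (hpart lt g v s l)
  = if tdeg lt g lam l rho == Some v then tcomp lam rho (s l) else 0.
Proof.
rewrite ffunE (morphB_sum (tcompB _ _)).
under eq_bigr => lam' _ do rewrite (morphB_sum (tcompB _ _)).
have [E|ne] := eqVneq; last first.
  rewrite big1 // => lam' _; rewrite big1 // => rho' E; rewrite tcomp_tcomp.
  by case: andP ne => // -[/eqP -> /eqP ->]; rewrite E.
have [x _ def_v] := tdegP E.
have lt_lam : (mdeg lam < (mdeg v.1).+1)%N.
  by rewrite def_v /= !mdegD ltnS -addnA leq_addr.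
have lt_rho : (mdeg rho < (mdeg v.1).+1)%N.
  by rewrite def_v /= !mdegD ltnS leq_addl.
rewrite (bigD1 (BMultinom lt_lam)) //= [X in _ + X]big1 ?addr0.
  rewrite (bigD1 (BMultinom lt_rho)) /= ?E // [X in _ + X]big1 ?addr0.
    by rewrite tcomp_tcomp !eqxx.
  move=> rho' /andP[_ ne]; rewrite tcomp_tcomp.
  by case: andP => // -[_ /eqP er]; case/eqP: ne; apply: val_inj.
move=> lam' ne; rewrite big1 // => rho' _; rewrite tcomp_tcomp.
by case: andP => // -[/eqP er _]; case/eqP: ne; apply: val_inj.
Qed.

(** The analogue of [supp_in] for syzygies, with the degrees of components in place of terms. *)
Definition comp_in (P : mterm n m -> Prop) s := forall lam l rho w,
  tdeg lt g lam l rho = Some w -> tcomp lam rho (s l) != 0 -> P w.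

Lemma comp_inD P s1 s2 : comp_in P s1 -> comp_in P s2 -> comp_in P (s1 + s2).
Proof.
move=> P1 P2 lam l rho w E; rewrite ffunE (morphBD (tcompB _ _)).
have [->|/(P1 _ _ _ _ E)//] := eqVneq (tcomp lam rho (s1 l)) 0.
by rewrite add0r; apply: P2.
Qed.

Lemma comp_in0 P : comp_in P 0.
Proof. by move=> lam l rho w _; rewrite ffunE (morphB0 (tcompB _ _)) eqxx. Qed.

Lemma hpart_eq0 v s : comp_in (lt^~ v) s -> hpart lt g v s = 0.
Proof.
move=> slt; apply/ffunP => l; rewrite [RHS]ffunE; apply: tcomp_eq0 => lam rho.
rewrite tcomp_hpart; case: eqP => // /slt lt_v.
by apply: contraTeq isT => /lt_v; rewrite (lt_nrefl lt_order).
Qed.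

Lemma has_maxdeg_exists s : s != 0 -> exists v, has_maxdeg lt g s v.
Proof.
move=> s0.
have /choice[N ltN] : forall l, exists N, forall lam rho,
    tcomp lam rho (s l) != 0 -> (mdeg lam < N)%N /\ (mdeg rho < N)%N.
  by move=> l; apply: tcomp_bounded.
have /choice[deg degE] : forall p : 'X_{1..n} * 'I_u * 'X_{1..n},
    exists w, tdeg lt g p.1.1 p.1.2 p.2 = Some w.
  by move=> p; apply: tdeg_exists.
pose K := \max_l N l.
(* The bound [K] is uniform in [l], so this finite type indexes all nonzero components of [s] and a
   maximum of their degrees can be taken. *)
pose T : finType := ('X_{1..n < K} * 'I_u * 'X_{1..n < K})%type.
pose r := [seq p <- enum T | tcomp (val p.1.1) (val p.2) (s p.1.2) != 0].
have r_comp lam l rho : tcomp lam rho (s l) != 0 ->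
    exists2 p : T, p \in r & (val p.1.1, p.1.2, val p.2) = (lam, l, rho).
  move=> nz; have [lt_lam lt_rho] := ltN _ _ _ nz.
  have leK : (N l <= K)%N by apply: leq_bigmax.
  exists (BMultinom (leq_trans lt_lam leK), l, BMultinom (leq_trans lt_rho leK)) => //.
  by rewrite mem_filter nz mem_enum.
have r0 : r != [::].
  apply: contra_neq s0 => r0; apply/ffunP => l; rewrite [RHS]ffunE.
  apply: tcomp_eq0 => lam rho; apply/eqP/negPn/negP => /r_comp[p].
  by rewrite r0.
pose d (p : T) := deg (val p.1.1, p.1.2, val p.2).
have [p pr pmax] := seq_max lt_order d r0.
exists (d p); split=> [|lam l rho w E /r_comp[q /pmax]].
  move: pr; rewrite mem_filter => /andP[nz _].
  by exists p.1.1, p.1.2, p.2; rewrite nz; split=> //; apply: (degE (_, _, _)).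
rewrite /d => + Eq; rewrite Eq.
by have := degE (lam, l, rho); rewrite E => -[<-].
Qed.

(** Uniqueness is what lets [xget] in [lform] return the expected homogeneous part. *)
Lemma has_maxdeg_inj s v v' : has_maxdeg lt g s v -> has_maxdeg lt g s v' -> v' = v.
Proof.
move=> [[lam [l [rho [E nz]]]] max] [[lam' [l' [rho' [E' nz']]]] max'].
case: (max _ _ _ _ E' nz') => // v'v; case: (max' _ _ _ _ E nz) => // vv'.
by have := lt_trans lt_order v'v vv'; rewrite (lt_nrefl lt_order).
Qed.

Lemma lformE s v : has_maxdeg lt g s v -> lform lt g s = hpart lt g v s.
Proof.
move=> sv; apply: xget_unique; first by exists v.
by move=> _ [v' /(has_maxdeg_inj sv) -> <-].
Qed.

(** The zero syzygy has no maximal degree, so [xget] falls back on its default value. *)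
Lemma lform0 : lform lt g (0 : {ffun 'I_u -> otens D}) = 0.
Proof.
apply: xgetPN => y [v [[lam [l [rho [_ +]]]] _] _].
by rewrite ffunE (morphB0 (tcompB _ _)) eqxx.
Qed.

Let tvDB f := tvactB (@subset_refl _ (ohat D)) f.
Let tvGB f := tvactB (@ohat_graded _ _ D) f.

(** Both claims are stable under subtraction, so [x] may be a pure tensor; its component is then a
    tensor of two monomials, the case settled for vectors. *)
Lemma supp_tvact_tcomp l lam rho w x : tdeg lt g lam l rho = Some w ->
  supp_in (eq^~ w) (tvact (graded D) (lmon lt (g l)) (tcomp lam rho x)) /\
  supp_in (lt^~ w) (tvact D (g l) (tcomp lam rho x)
    - tvact (graded D) (lmon lt (g l)) (tcomp lam rho x)).
Proof.
move=> /tdegP[y gy ->]; elim/tensor_ind: x => [|x1 x2 [IH1 IH1'] [IH2 IH2']|f h].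
- rewrite (morphB0 (tcompB _ _)) (morphB0 (tvDB _)) (morphB0 (tvGB _)) subrr.
  by split; apply: supp_in0.
- rewrite tcompB tvDB tvGB; split; first exact: supp_inB.
  by rewrite opprD addrACA -opprD; apply: supp_inB.
rewrite tcomp_tens (tvact_tens (@subset_refl _ (ohat D))).
rewrite (tvact_tens (@ohat_graded _ _ D)).
by split; [apply: supp_vact_lmon | apply: (supp_vact_sub_lmon prec_order)].
Qed.

Lemma supp_syzs2_hpart v s : supp_in (eq^~ v) (syzs2 lt g (hpart lt g v s)).
Proof.
rewrite /syzs2 symapE; apply: supp_in_sum => l _.
have [k /(_ k (leqnn k)) ->] := tcomp_decomp (hpart lt g v s l).
rewrite (morphB_sum (tvGB _)); apply: supp_in_sum => lam _.
rewrite (morphB_sum (tvGB _)); apply: supp_in_sum => rho _.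
rewrite tcomp_hpart; case: eqP => [/(supp_tvact_tcomp (s l))[] //|_].
by rewrite (morphB0 (tvGB _)); apply: supp_in0.
Qed.

(** Compare component by component: one of degree [v] leaves an error below [v], while one of
    smaller degree is absent from [hpart] and has an image with terms below [v] anyway. *)
Lemma supp_syzS2_sub v s : comp_in (mleq lt ^~ v) s ->
  supp_in (lt^~ v) (syzS2 g s - syzs2 lt g (hpart lt g v s)).
Proof.
move=> sv; rewrite /syzS2 /syzs2 !symapE -sumrB; apply: supp_in_sum => l _.
have [k1 /(_ _ (leq_maxl _ _)) E1] := tcomp_decomp (s l).
have [k2 /(_ _ (leq_maxr _ _)) E2] := tcomp_decomp (hpart lt g v s l).
(* Both decompositions now range over terms of degree below [maxn k1 k2], so the sums can be
   subtracted termwise. *)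
rewrite (E1 k2) (E2 k1).
rewrite (morphB_sum (tvDB _)) (morphB_sum (tvGB _)) -sumrB.
apply: supp_in_sum => lam _.
rewrite (morphB_sum (tvDB _)) (morphB_sum (tvGB _)) -sumrB.
apply: supp_in_sum => rho _; rewrite tcomp_hpart.
have [->|nz] := eqVneq (tcomp lam rho (s l)) 0.
  by rewrite if_same (morphB0 (tvDB _)) (morphB0 (tvGB _)) subrr; apply: supp_in0.
have [w E] := tdeg_exists lam l rho.
have [eq_w lt_w] := supp_tvact_tcomp (s l) E; rewrite E.
case: eqP => [[<-] //|ne]; case: (sv _ _ _ _ E nz) => [ew|wv].
  by rewrite ew in ne.
rewrite (morphB0 (tvGB _)) subr0 -[tvact _ _ _](subrK
  (tvact (graded D) (lmon lt (g l)) (tcomp lam rho (s l)))).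
apply: supp_inD.
  by apply: supp_inW lt_w => y yw; apply: (lt_trans lt_order) yw wv.
by apply: supp_inW eq_w => y ->.
Qed.

(** The image of the leading form is concentrated in the single term [v]; since [syzS2 g h]
    vanishes, its terms must also lie strictly below [v], so there are none. *)
Lemma lform_in_ker (h : {ffun 'I_u -> otens D}) :
  h != 0 -> syzS2 g h = 0 -> syzs2 lt g (lform lt g h) = 0.
Proof.
move=> /has_maxdeg_exists[v hv] h0; rewrite (lformE hv).
have := @supp_syzS2_sub v h (fun lam l rho w => proj2 hv lam l rho w).
rewrite h0 sub0r => lt_v; apply: supp_in_eq0 => t i nz.
have eq_v := supp_syzs2_hpart nz.
have := lt_v t i; rewrite eq_v !ffunE mcoeffN oppr_eq0 => /(_ nz).
by rewrite (lt_nrefl lt_order).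
Qed.

Definition elem_tens a lam l b rho : {ffun 'I_u -> otens D} :=
  [ffun j => if j == l then tens (ohat D) (a *: 'X_[lam]) (b *: 'X_[rho]) else 0].

Lemma comp_in_elem_tens (P : mterm n m -> Prop) a lam l b rho w :
  tdeg lt g lam l rho = Some w -> P w -> comp_in P (elem_tens a lam l b rho).
Proof.
move=> E Pw lam' l' rho' w' E'; rewrite ffunE.
have [ll'|_] := eqVneq l' l; last by rewrite (morphB0 (tcompB _ _)) eqxx.
have T := tens_balanced (ohat D) {mpoly R[n]} {mpoly R[n]}.
rewrite tcomp_tens !mcoeffZ !mcoeffX; have [lamE|_] := eqVneq lam lam'; last first.
  by rewrite mulr0 scale0r (morphB0 (balancedBl T _)) eqxx.
have [rhoE|_] := eqVneq rho rho'; last first.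
  by rewrite [_ * false%:R]mulr0 scale0r (morphB0 (balancedBr T _)) eqxx.
by move: E'; rewrite ll' -lamE -rhoE E => -[<-].
Qed.

Lemma syzS2_elem_tens a lam l b rho : syzS2 g (elem_tens a lam l b rho)
  = vact (a *: 'X_[lam] : ore D) (g l) (b *: 'X_[rho]).
Proof.
rewrite /syzS2 symapE (bigD1 l) //= big1 ?addr0 => [|j jl].
  by rewrite ffunE eqxx (tvact_tens (@subset_refl _ (ohat D))).
by rewrite ffunE (negPf jl) (morphB0 (tvDB _)).
Qed.

Lemma syzS2B : {morph @syzS2 R n D u m g : s1 s2 / s1 - s2}.
Proof. exact: symapB. Qed.

Lemma vactNl (l : ore D) (f : mvec R n m) (r : ore D) : vact (- l) f r = - vact l f r.
Proof. by apply/ffunP => i; rewrite !ffunE !mulNr. Qed.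

Hypothesis g_groebner : bilateral_groebner D lt g.

(** Well-founded induction on the strict bound [v]: a representation of the leading monomial of [f]
    yields a syzygy whose image cancels that monomial, and the remainder is bounded by the leading
    term [x], itself below [v]. *)
Lemma groebner_lift v f : supp_in (lt^~ v) f ->
    bispan (@vact R n m D) (range g) f ->
  exists2 h, syzS2 g h = f & comp_in (lt^~ v) h.
Proof.
have wf_lt : well_founded (fun x y => lt x y) by case: lt_order => -[].
elim/(well_founded_induction wf_lt): v f => v IH f f_lt fM.
have [->|f0] := eqVneq f 0.
  by exists 0; [apply: (morphB0 syzS2B) | apply: comp_in0].
have [x fx] := lterm_exists lt_order f0.
have [fx0 _] := ltermP fx; have xv := f_lt _ _ fx0; rewrite -surjective_pairing in xv.
have [k [a [b [lam [rho [l [deg_x def_lmon]]]]]]] := g_groebner f0 fM.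
pose h i := elem_tens (a i) (lam i) (l i) (b i) (rho i).
have hx i : tdeg lt g (lam i) (l i) (rho i) = Some x by case: (deg_x i) => _ _ ->.
pose h0 := \sum_i h i.
have S_h0 : syzS2 g h0
    = \sum_i vact (a i *: 'X_[lam i] : ore D) (g (l i)) (b i *: 'X_[rho i]).
  by rewrite (morphB_sum syzS2B); apply: eq_bigr => i _; apply: syzS2_elem_tens.
have f'M : bispan (@vact R n m D) (range g) (f - syzS2 g h0).
  apply: (bispanB vactNl) => //; rewrite S_h0.
  by exists k, (fun i => a i *: 'X_[lam i]), (fun i => b i *: 'X_[rho i]), (g \o l).
(* The tail of [f] lies below [x], and so does each difference between a graded summand of the
   leading monomial and its Ore counterpart in the image of [h0]. *)
have f'_lt : supp_in (lt^~ x) (f - syzS2 g h0).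
  rewrite -[f](subrK (lmon lt f)) -addrA; apply: supp_inD.
    exact: supp_sub_lmon.
  rewrite def_lmon S_h0 -sumrB; apply: supp_in_sum => i _.
  rewrite -opprB -sub0r; apply: supp_inB; first exact: supp_in0.
  have [y gy ->] := tdegP (hx i).
  exact: (supp_vact_sub_lmon prec_order).
have [h' S_h' h'x] := IH x xv _ f'_lt f'M.
exists (h0 + h'); first by rewrite (morphBD syzS2B) S_h' addrC subrK.
apply: comp_inD; last first.
  by move=> lam' l' rho' w E /(h'x _ _ _ _ E) wx; apply: (lt_trans lt_order) wx xv.
apply: big_ind => [||i _]; [exact: comp_in0 | exact: comp_inD |].
exact: comp_in_elem_tens (hx i) xv.
Qed.

Lemma bispan_syzS2 s : bispan (@vact R n m D) (range g) (syzS2 g s).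
Proof.
have BD := bispanD (act := @vact R n m D).
rewrite /syzS2 symapE; apply: big_ind => [||l _]; [exact: bispan0 | exact: BD |].
elim/tensor_ind: (s l) => [|x y IHx IHy|h k].
- by rewrite (morphB0 (tvDB _)); apply: bispan0.
- by rewrite tvDB; apply: (bispanB vactNl).
rewrite (tvact_tens (@subset_refl _ (ohat D))).
exists 1%N, (fun=> h), (fun=> k), (fun=> g l).
by rewrite big_ord1; split=> // _; exists l.
Qed.

(** The correction [h] has only components of degree below [v], so subtracting it kills the image
    and leaves the leading form untouched. *)
Lemma lifting_exists s : s != 0 -> lform lt g s = s -> syzs2 lt g s = 0 ->
  exists U, is_lifting lt g s U.
Proof.
move=> s0 s_hom s_ker; have [v sv] := has_maxdeg_exists s0.
have hpart_s : hpart lt g v s = s by rewrite -lformE.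
have := @supp_syzS2_sub v s (fun lam l rho w => proj2 sv lam l rho w).
rewrite hpart_s s_ker subr0 => /groebner_lift[]; first exact: bispan_syzS2.
move=> h S_h h_lt; exists (s - h); split; first by rewrite syzS2B S_h subrr.
have sh lam l rho w : tdeg lt g lam l rho = Some w -> ~ lt w v ->
    tcomp lam rho ((s - h) l) = tcomp lam rho (s l).
  move=> E w_v; rewrite tcomp_ffunB; have [->|/(h_lt _ _ _ _ E)//] :=
    eqVneq (tcomp lam rho (h l)) 0; exact: subr0.
(* A component of degree not below [v] is the same in [s - h] as in [s], so the maximal degree is
   still [v]. *)
have shv : has_maxdeg lt g (s - h) v.
  case: sv => -[lam [l [rho [E nz]]]] s_le; split.
    by exists lam, l, rho; rewrite E (sh _ _ _ v) // (lt_nrefl lt_order).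
  move=> lam' l' rho' w E'; have [wv|/(sh _ _ _ _ E') ->] := pselect (lt w v).
    by right.
  exact: s_le E'.
by rewrite (lformE shv) hpartB hpart_s (hpart_eq0 h_lt) subr0.
Qed.
End SyzTheory.

(** * From liftings to a standard basis *)

Lemma standard_basis_lift (R : nzRingType) (n m u : nat) (D : ore_data R n)
    (prec : rel 'X_{1..n}) (lt : rel (mterm n m)) (g : 'I_u -> mvec R n m)
    (GM : set {ffun 'I_u -> otens D})
    (lift : {ffun 'I_u -> otens D} -> {ffun 'I_u -> otens D}) :
    term_order prec -> module_term_order prec lt -> (forall l, g l != 0) ->
    gebauer_moeller lt g GM -> (forall s, GM s -> is_lifting lt g s (lift s)) ->
  standard_basis lt g [set lift s | s in GM] [set s | syzS2 g s = 0].
Proof.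
move=> prec_order lt_order g_neq0 [GM_hom GM_gen] liftP.
have lift_ker : [set lift s | s in GM] `<=` [set s | syzS2 g s = 0].
  by move=> _ [s GMs <-]; case: (liftP _ GMs).
have GM_lift : GM `<=` [set lform lt g b | b in [set lift s | s in GM] `\ 0].
  move=> s GMs; have [_ lform_s] := liftP _ GMs.
  exists (lift s) => //; split; first by exists s.
  (* A zero lifting would have leading form 0, but this form is [s], which is nonzero. *)
  move=> lift0; have [/eqP[]] := GM_hom _ GMs.
  by rewrite -lform_s lift0 lform0.
split=> //; apply/seteqP; split.
  by apply: bispanS => _ [b [/lift_ker b_ker b0] <-]; exists b.
have GM_idem : bispan (@sact R n D u (graded D)) (bispan (@sact R n D u (graded D)) GM)
    `<=` bispan (@sact R n D u (graded D)) GM.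
  by apply: bispan_idem; [apply/sactB/ohat_graded | apply/sactA/ohat_graded].
(* Leading forms of the kernel of [syzS2] lie in the kernel of [syzs2], the span of [GM]; by
   idempotence they generate nothing larger, and [GM] consists of leading forms of liftings. *)
apply: subset_trans (bispanS GM_lift); apply: subset_trans GM_idem.
rewrite GM_gen; apply: bispanS => _ [h [h_ker /eqP h0] <-].
exact: (lform_in_ker prec_order lt_order g_neq0).
Qed.

Theorem theorem38 (R : nzRingType) (domR : GRing.integral_domain_axiom R)
    (n m u : nat) (D : ore_data R n)
    (prec : rel 'X_{1..n}) (lt : rel (mterm n m))
    (prec_order : term_order prec) (lt_order : module_term_order prec lt)
    (g : 'I_u -> mvec R n m) (g_neq0 : forall l, g l != 0)
    (g_groebner : bilateral_groebner D lt g)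
    (GM : set {ffun 'I_u -> otens D}) (GM_gm : gebauer_moeller lt g GM) :
  (forall s, GM s -> exists U, is_lifting lt g s U) /\
  (forall lift : {ffun 'I_u -> otens D} -> {ffun 'I_u -> otens D},
     (forall s, GM s -> is_lifting lt g s (lift s)) ->
     standard_basis lt g [set lift s | s in GM] [set s | syzS2 g s = 0]).
Proof.
split=> [s GMs|lift liftP]; last exact: (@standard_basis_lift _ _ _ _ _ prec).
have [/(_ s GMs)[s0 s_hom] GM_ker] := GM_gm.
apply: (lifting_exists prec_order) => //.
(* A generator is in the kernel of [syzs2] because it lies in its own span, as 1 times [s] times
   1. *)
suff : bispan (@sact R n D u (graded D)) GM s by rewrite GM_ker.
exists 1%N, (fun=> 1), (fun=> 1), (fun=> s); split=> //.
by rewrite big_ord1 sact1 //; apply: ohat_graded.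
Qed.
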